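(* Let $k$ be a field and let $\mathcal{B}$ be a $k$-category such that the endomorphism ring of each object is reduced to $k$. Let $F:\mathcal{C}\to\mathcal{B}$ be a Galois covering. Then there exists a canonical injective ($k$-linear) morphism $$\Delta:\mathrm{Hom}(\mathrm{Aut}_1(F),k^+)\longrightarrow H^1(\mathcal{B},\mathcal{B}).$$
   Context: A $k$-category is a small category $\mathcal{B}$ with object set $\mathcal{B}_0$, in which each morphism set ${}_y\mathcal{B}_x$ from $x$ to $y$ is a $k$-module, composition is $k$-bilinear, and $k$-multiples of the identity at each object are central in its endomorphism ring. A $k$-functor is a functor that is $k$-linear on morphisms. The star at an object $b_0$ is $\mathrm{St}_{b_0}\mathcal{B}=\left(\bigoplus_{y\in\mathcal{B}_0}{}_y\mathcal{B}_{b_0}\right)\oplus\left(\bigoplus_{y\in\mathcal{B}_0}{}_{b_0}\mathcal{B}_y\right)$. A $k$-functor $F:\mathcal{C}\to\mathcal{B}$ is a covering if it is surjective on objects and, for each $b_0\in\mathcal{B}_0$ and each $x\in F^{-1}(b_0)$, the map $\mathrm{St}_x\mathcal{C}\to\mathrm{St}_{b_0}\mathcal{B}$ induced by $F$ is an isomorphism of $k$-modules. A $k$-category $\mathcal{B}$ is connected if for any two objects $b,c$ there is a finite sequence of objects $b=x_1,\dots,x_n=c$ such that for each $1\le i<n$ there is a non-zero morphism in ${}_{x_{i+1}}\mathcal{B}_{x_i}$ or in ${}_{x_i}\mathcal{B}_{x_{i+1}}$. For a covering $F:\mathcal{C}\to\mathcal{B}$, $\mathrm{Aut}_1(F)$ is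 the group of pairs $(H,1)$ with $H$ an automorphism of the $k$-category $\mathcal{C}$ such that $FH=F$. A covering $F$ is a Galois covering if $\mathcal{C}$ is connected and $\mathrm{Aut}_1(F)$ acts transitively on some fibre $F^{-1}(b)$. $k^+$ is the additive group of $k$ and $\mathrm{Hom}(\mathrm{Aut}_1(F),k^+)$ is the $k$-vector space of group homomorphisms (abelian characters). The endomorphism ring of $b$ is reduced to $k$ if ${}_b\mathcal{B}_b=k\cdot 1_b\cong k$. A derivation of $\mathcal{B}$ is a collection $D=({}_cD_b)_{c,b\in\mathcal{B}_0}$ of $k$-linear endomorphisms of the $k$-modules ${}_c\mathcal{B}_b$ such that $D(gf)=gD(f)+D(g)f$ for all composable morphisms. The inner derivation associated with a family $\alpha=(\alpha_b)_{b\in\mathcal{B}_0}$, $\alpha_b\in{}_b\mathcal{B}_b$, is $D_\alpha(f)=\alpha_c f-f\alpha_b$ for $f\in{}_c\mathcal{B}_b$. The first Hochschild(-Mitchell) cohomology $H^1(\mathcal{B},\mathcal{B})$ is the quotient of the $k$-module of derivations by the inner ones. The word ''canonical'' refers to the following map. A choice of objects $x_b\in F^{-1}(b)$, $b\in\mathcal{B}_0$, yields decompositions ${}_c\mathcal{B}_b=\bigoplus_{s\in\mathrm{Aut}_1(F)}Z_s({}_c\mathcal{B}_b)$ with $Z_s({}_c\mathcal{B}_b)=F({}_{sx_c}\mathcal{C}_{x_b})$, and $\Delta(\chi)$ is the class of the derivation given by $f\mapsto\chi(s)f$ for $f\in Z_s({}_c\mathcal{B}_b)$; this class does not depend on the choice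 of the objects $x_b$. *)

(* Defs.v *)
From HB Require Import structures.
From mathcomp Require Import all_boot all_algebra.
From mathcomp Require Import boolp classical_sets functions cardinality fsbigop.

Set Implicit Arguments.
Unset Strict Implicit.
Unset Printing Implicit Defensive.

Import GRing.Theory.
Local Open Scope classical_set_scope.
Local Open Scope ring_scope.

(* [kcat_hom y x] is the module of morphisms from [x] to [y].  That multiples
   of the identities are central follows from bilinearity: see [kid_central]. *)
Record kcategory (k : comNzRingType) := KCategory {
  kcat_obj :> choiceType;
  kcat_hom : kcat_obj -> kcat_obj -> lmodType k;
  kid : forall x, kcat_hom x x;
  kcomp : forall z y x, kcat_hom z y -> kcat_hom y x -> kcat_hom z x;
  kcompA : forall w z y x (h : kcat_hom w z) (g : kcat_hom z y)
    (f : kcat_hom y x), kcomp h (kcomp g f) = kcomp (kcomp h g) f;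
  kcomp1l : forall y x (f : kcat_hom y x), kcomp (kid y) f = f;
  kcomp1r : forall y x (f : kcat_hom y x), kcomp f (kid x) = f;
  kcomp_linearl : forall z y x (f : kcat_hom y x),
    linear (fun g : kcat_hom z y => kcomp g f);
  kcomp_linearr : forall z y x (g : kcat_hom z y),
    linear (fun f : kcat_hom y x => kcomp g f)
}.

Notation hom := kcat_hom.
Arguments kid {k k0} x : rename.
Notation "g \c f" := (kcomp g f) (at level 40, left associativity).

Section KCategoryTheory.
Variables (k : comNzRingType) (B : kcategory k).

HB.instance Definition _ z y x (g : hom z y) :=
  GRing.isLinear.Build k (hom y x) (hom z x) *:%R
    (@kcomp k B z y x g) (@kcomp_linearr k B z y x g).

Definition kcompr z y x (f : hom y x) (g : hom z y) : @hom k B z x := g \c f.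

HB.instance Definition _ z y x (f : hom y x) :=
  GRing.isLinear.Build k (hom z y) (hom z x) *:%R
    (@kcompr z y x f) (@kcomp_linearl k B z y x f).

Lemma kcompDl z y x (g h : hom z y) (f : @hom k B y x) :
  (g + h) \c f = g \c f + h \c f.
Proof. exact: (raddfD (kcompr f)). Qed.
Lemma kcompNl z y x (g : hom z y) (f : @hom k B y x) : (- g) \c f = - (g \c f).
Proof. exact: (raddfN (kcompr f)). Qed.
Lemma kcompZl z y x a (g : hom z y) (f : @hom k B y x) :
  (a *: g) \c f = a *: (g \c f).
Proof. exact: (linearZ_LR (kcompr f)). Qed.
Lemma kcompDr z y x (g : hom z y) (e f : @hom k B y x) :
  g \c (e + f) = g \c e + g \c f.
Proof. exact: raddfD. Qed.
Lemma kcompNr z y x (g : hom z y) (f : @hom k B y x) : g \c (- f) = - (g \c f).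
Proof. exact: raddfN. Qed.
Lemma kcompZr z y x a (g : hom z y) (f : @hom k B y x) :
  g \c (a *: f) = a *: (g \c f).
Proof. exact: linearZ_LR. Qed.
Lemma kcomp0l z y x (f : @hom k B y x) : (0 : hom z y) \c f = 0.
Proof. exact: (raddf0 (kcompr f)). Qed.
Lemma kcomp0r z y x (g : @hom k B z y) : g \c (0 : hom y x) = 0.
Proof. exact: raddf0. Qed.

Lemma kid_central a (x : B) (f : hom x x) : (a *: kid x) \c f = f \c (a *: kid x).
Proof. by rewrite kcompZl kcompZr kcomp1l kcomp1r. Qed.

Definition linked (x y : B) : Prop :=
  (exists f : hom y x, f != 0) \/ (exists f : hom x y, f != 0).

Definition kconnected : Prop := forall b c : B,
  exists s : seq B, path (fun x y => `[< linked x y >]) b s /\ last b s = c.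

(* The endomorphism ring of [b] is free of rank one on the identity. *)
Definition reduced_endo (b : B) : Prop := bijective (fun a : k => a *: kid b).

End KCategoryTheory.

Record kfunctor (k : comNzRingType) (C B : kcategory k) := KFunctor {
  fobj :> C -> B;
  fmap : forall y x : C, hom y x -> hom (fobj y) (fobj x);
  fmap_linear : forall y x, linear (@fmap y x);
  fmap1 : forall x, fmap (kid x) = kid (fobj x);
  fmapM : forall z y x (g : hom z y) (f : hom y x),
    fmap (g \c f) = fmap g \c fmap f
}.
Arguments fmap {k C B} F [y x] f : rename.

HB.instance Definition _ (k : comNzRingType) (C B : kcategory k)
    (F : kfunctor C B) (y x : C) :=
  GRing.isLinear.Build k (hom y x) (hom (F y) (F x)) *:%R
    (@fmap k C B F y x) (@fmap_linear k C B F y x).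

Section FunctorCategory.
Variable k : comNzRingType.

(* By proof irrelevance, Leibniz equality of [kfunctor]s is equality of
   functors. *)
Lemma kfunctor_eq (C B : kcategory k) (o : C -> B)
    (m : forall y x : C, hom y x -> hom (o y) (o x)) l1 u1 c1 l2 u2 c2 :
  @KFunctor k C B o m l1 u1 c1 = @KFunctor k C B o m l2 u2 c2.
Proof.
by rewrite (Prop_irrelevance l1 l2) (Prop_irrelevance u1 u2)
  (Prop_irrelevance c1 c2).
Qed.

Definition kfid (C : kcategory k) : kfunctor C C.
Proof. by exists id (fun y x f => f). Defined.

Definition kfcomp (C B A : kcategory k) (G : kfunctor B A) (F : kfunctor C B) :
  kfunctor C A.
Proof.
exists (G \o F) (fun y x f => fmap G (fmap F f)).
- by move=> y x a f g; rewrite !linearP.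
- by move=> x; rewrite !fmap1.
- by move=> z y x g f; rewrite !fmapM.
Defined.

Lemma kfcompA (D C B A : kcategory k) (H : kfunctor B A) (G : kfunctor C B)
    (F : kfunctor D C) :
  kfcomp H (kfcomp G F) = kfcomp (kfcomp H G) F.
Proof. exact: kfunctor_eq. Qed.

Lemma kfcomp1l (C B : kcategory k) (F : kfunctor C B) : kfcomp (kfid B) F = F.
Proof. by case: F => *; exact: kfunctor_eq. Qed.

Lemma kfcomp1r (C B : kcategory k) (F : kfunctor C B) : kfcomp F (kfid C) = F.
Proof. by case: F => *; exact: kfunctor_eq. Qed.

End FunctorCategory.

(* Elements of the direct sum of a family of modules: dependent functions of
   finite support. *)
Section DirectSum.
Variables (k : comNzRingType) (I : choiceType) (M : I -> lmodType k).

Record dsum := DSum {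
  dsum_fun :> forall i, M i;
  dsum_finite : finite_set [set i | dsum_fun i != 0]
}.

Lemma dsumP (u v : dsum) : (forall i, u i = v i) -> u = v.
Proof.
case: u v => [u fu] [v fv] /= uv.
have {}uv : u = v by apply: functional_extensionality_dep.
by rewrite uv in fu *; congr DSum; exact: Prop_irrelevance.
Qed.

HB.instance Definition _ := gen_eqMixin dsum.
HB.instance Definition _ := gen_choiceMixin dsum.

Lemma dsum0_finite : finite_set [set i | (0 : M i) != 0].
Proof. by apply: (sub_finite_set _ (finite_set0 I)) => i /=; rewrite eqxx. Qed.

Lemma dsumN_finite (u : dsum) : finite_set [set i | - u i != 0].
Proof.
by apply: (sub_finite_set _ (dsum_finite u)) => i /=; rewrite oppr_eq0.
Qed.

Lemma dsumD_finite (u v : dsum) : finite_set [set i | u i + v i != 0].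
Proof.
apply: (@sub_finite_set _ _ ([set i | u i != 0] `|` [set i | v i != 0])).
  move=> i /=; have [->|] := eqVneq (u i) 0; last by left.
  by rewrite add0r; right.
by rewrite finite_setU; split; exact: dsum_finite.
Qed.

Lemma dsumZ_finite a (u : dsum) : finite_set [set i | a *: u i != 0].
Proof.
apply: (sub_finite_set _ (dsum_finite u)) => i /=.
by apply: contra_neq => ->; rewrite scaler0.
Qed.

Definition dsum0 := DSum dsum0_finite.
Definition dsumN u := DSum (dsumN_finite u).
Definition dsumD u v := DSum (dsumD_finite u v).
Definition dsumZ a u := DSum (dsumZ_finite a u).

Let dsumA : associative dsumD.
Proof. by move=> u v w; apply: dsumP => i /=; rewrite addrA. Qed.
Let dsumC : commutative dsumD.
Proof. by move=> u v; apply: dsumP => i /=; rewrite addrC. Qed.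
Let dsum0D : left_id dsum0 dsumD.
Proof. by move=> u; apply: dsumP => i /=; rewrite add0r. Qed.
Let dsumND : left_inverse dsum0 dsumN dsumD.
Proof. by move=> u; apply: dsumP => i /=; rewrite addNr. Qed.
HB.instance Definition _ := GRing.isZmodule.Build dsum dsumA dsumC dsum0D dsumND.

Let dsumZA a b u : dsumZ a (dsumZ b u) = dsumZ (a * b) u.
Proof. by apply: dsumP => i /=; rewrite scalerA. Qed.
Let dsum1Z : left_id 1 dsumZ.
Proof. by move=> u; apply: dsumP => i /=; rewrite scale1r. Qed.
Let dsumZDr : right_distributive dsumZ +%R.
Proof. by move=> a u v; apply: dsumP => i /=; rewrite scalerDr. Qed.
Let dsumZDl u : {morph dsumZ^~ u : a b / a + b}.
Proof. by move=> a b; apply: dsumP => i /=; rewrite scalerDl. Qed.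
HB.instance Definition _ :=
  GRing.Zmodule_isLmodule.Build k dsum dsumZA dsum1Z dsumZDr dsumZDl.

Lemma dsum_in_finite i (m : M i) :
  finite_set [set j : I | dfwith (fun j => 0 : M j) m j != 0].
Proof.
apply: (sub_finite_set _ (finite_set1 i)) => j /=.
by case: dfwithP => // {}j _; rewrite eqxx.
Qed.

Definition dsum_in i (m : M i) : dsum := DSum (dsum_in_finite m).

Lemma dsum_in_linear i : linear (@dsum_in i).
Proof.
move=> a m n; apply: dsumP => j /=.
have [<-|ij] := eqVneq i j; first by rewrite !dfwith_in.
by rewrite !dfwith_out// scaler0 addr0.
Qed.
HB.instance Definition _ i :=
  GRing.isLinear.Build k (M i) dsum *:%R (@dsum_in i) (@dsum_in_linear i).

End DirectSum.

Section DirectSumMap.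
Variables (k : comNzRingType) (I J : choiceType).
Variables (M : I -> lmodType k) (N : J -> lmodType k).
Variables (h : I -> J) (g : forall i, {linear M i -> N (h i)}).

Definition dsum_map (u : dsum M) : dsum N :=
  \sum_(i \in [set: I]) dsum_in (g i (u i)).

Lemma dsum_map_linear : linear dsum_map.
Proof.
move=> a u v; rewrite /dsum_map.
set w := a *: u + v.
pose S := [set i | u i != 0] `|` [set i | v i != 0].
have finS : finite_set S.
  by rewrite finite_setU; split; exact: dsum_finite.
have restr (t : dsum M) : (forall i, ~ S i -> t i = 0) ->
    \sum_(i \in [set: I]) dsum_in (g i (t i)) =
    \sum_(i \in S) dsum_in (g i (t i)).
  move=> t0; apply/esym/fsbig_widen => // i [_ /= Si].
  by rewrite t0// !linear0.
have Su i : ~ S i -> u i = 0.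
  by move=> nS; apply/eqP; apply: contra_notT nS => ?; left.
have Sv i : ~ S i -> v i = 0.
  by move=> nS; apply/eqP; apply: contra_notT nS => ?; right.
rewrite !restr//; last first.
  by move=> i nS; rewrite /w /= Su// Sv// scaler0 addr0.
rewrite !fsbig_finite//= scaler_sumr -big_split/=; apply: eq_bigr => i _.
by rewrite !linearP.
Qed.
HB.instance Definition _ :=
  GRing.isLinear.Build k (dsum M) (dsum N) *:%R dsum_map dsum_map_linear.

End DirectSumMap.

Section Covering.
Variable k : comNzRingType.

Definition star (B : kcategory k) (b : B) : lmodType k :=
  (dsum (fun y : B => hom y b) * dsum (fun y : B => hom b y))%type.

Variables (C B : kcategory k) (F : kfunctor C B).

Definition star_map (x : C) (u : star x) : star (F x) :=
  (dsum_map (N := fun y => hom y (F x)) (fun y => @fmap k C B F y x) u.1,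
   dsum_map (N := fun y => hom (F x) y) (fun y => @fmap k C B F x y) u.2).

Lemma star_map_linear x : linear (@star_map x).
Proof. by move=> a u v; rewrite /star_map !linearP. Qed.
HB.instance Definition _ x :=
  GRing.isLinear.Build k (star x) (star (F x)) *:%R
    (@star_map x) (@star_map_linear x).

(* The condition on each [b] and each [x] in the fibre of [b] is stated at
   [b := F x]. *)
Definition covering : Prop :=
  (forall b : B, exists x : C, F x = b) /\
  (forall x : C, bijective (@star_map x)).

(* Automorphisms [H] of [C] with [F H = F], each carrying its inverse. *)
Record Aut1 := MkAut1 {
  aut_fun :> kfunctor C C;
  aut_inv : kfunctor C C;
  aut_invl : kfcomp aut_inv aut_fun = kfid C;
  aut_invr : kfcomp aut_fun aut_inv = kfid C;
  aut_over : kfcomp F aut_fun = F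
}.

Lemma Aut1P (s t : Aut1) : aut_fun s = aut_fun t -> s = t.
Proof.
case: s t => [s s' sl sr so] [t t' tl tr to] /= st; subst t.
have e : s' = t' by rewrite -[s']kfcomp1r -tr kfcompA sl kfcomp1l.
subst t'; congr MkAut1; exact: Prop_irrelevance.
Qed.

HB.instance Definition _ := gen_eqMixin Aut1.
HB.instance Definition _ := gen_choiceMixin Aut1.

Definition aut1_one : Aut1.
Proof. by exists (kfid C) (kfid C); rewrite ?kfcomp1r. Defined.

Definition aut1_inv (s : Aut1) : Aut1.
Proof.
exists (aut_inv s) (aut_fun s).
- exact: aut_invr.
- exact: aut_invl.
- by rewrite -[F in LHS](aut_over s) -kfcompA aut_invr kfcomp1r.
Defined.

Definition aut1_mul (s t : Aut1) : Aut1.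
Proof.
exists (kfcomp s t) (kfcomp (aut_inv t) (aut_inv s)).
- by rewrite kfcompA -(kfcompA (aut_inv t)) aut_invl kfcomp1r aut_invl.
- by rewrite kfcompA -(kfcompA s) aut_invr kfcomp1r aut_invr.
- by rewrite kfcompA !aut_over.
Defined.

Let aut1_mulA : associative aut1_mul.
Proof. by move=> s t u; apply: Aut1P; rewrite /= kfcompA. Qed.
Let aut1_mul1l : left_id aut1_one aut1_mul.
Proof. by move=> s; apply: Aut1P; rewrite /= kfcomp1l. Qed.
Let aut1_mul1r : right_id aut1_one aut1_mul.
Proof. by move=> s; apply: Aut1P; rewrite /= kfcomp1r. Qed.
Let aut1_mulVl : left_inverse aut1_one aut1_inv aut1_mul.
Proof. by move=> s; apply: Aut1P; rewrite /= aut_invl. Qed.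
Let aut1_mulVr : right_inverse aut1_one aut1_inv aut1_mul.
Proof. by move=> s; apply: Aut1P; rewrite /= aut_invr. Qed.
HB.instance Definition _ := isGroup.Build Aut1
  aut1_mulA aut1_mul1l aut1_mul1r aut1_mulVl aut1_mulVr.

Definition galois_covering : Prop :=
  [/\ covering, kconnected C &
    exists b : B, forall x y : C, F x = b -> F y = b ->
      exists s : Aut1, s x = y].

Lemma aut1_fibre (s : Aut1) (x : C) : F (s x) = F x.
Proof. exact: (congr1 (fun G : kfunctor C B => G x) (aut_over s)). Qed.

End Covering.

(* Homomorphisms from a multiplicative group to the additive group of [k]. *)
Section Characters.
Variables (k : comNzRingType) (G : groupType).

Record addchar := AddChar {
  addchar_fun :> G -> k;
  addcharM : forall s t, addchar_fun (s * t)%g = addchar_fun s + addchar_fun t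
}.

Lemma addcharP (f g : addchar) : (forall s, f s = g s) -> f = g.
Proof.
case: f g => [f fM] [g gM] /= fg; have {}fg : f = g by apply/funext.
by subst g; congr AddChar; exact: Prop_irrelevance.
Qed.

HB.instance Definition _ := gen_eqMixin addchar.
HB.instance Definition _ := gen_choiceMixin addchar.

Definition addchar0 : addchar.
Proof. by exists (fun=> 0) => s t; rewrite addr0. Defined.
Definition addcharN (f : addchar) : addchar.
Proof. by exists (fun s => - f s) => s t; rewrite addcharM opprD. Defined.
Definition addcharD (f g : addchar) : addchar.
Proof. by exists (fun s => f s + g s) => s t; rewrite !addcharM addrACA. Defined.
Definition addcharZ (a : k) (f : addchar) : addchar.
Proof. by exists (fun s => a * f s) => s t; rewrite addcharM mulrDr. Defined.

Let addcharDA : associative addcharD.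
Proof. by move=> u v w; apply: addcharP => i /=; rewrite addrA. Qed.
Let addcharDC : commutative addcharD.
Proof. by move=> u v; apply: addcharP => i /=; rewrite addrC. Qed.
Let addchar0D : left_id addchar0 addcharD.
Proof. by move=> u; apply: addcharP => i /=; rewrite add0r. Qed.
Let addcharND : left_inverse addchar0 addcharN addcharD.
Proof. by move=> u; apply: addcharP => i /=; rewrite addNr. Qed.
HB.instance Definition _ :=
  GRing.isZmodule.Build addchar addcharDA addcharDC addchar0D addcharND.

Let addcharZA a b u : addcharZ a (addcharZ b u) = addcharZ (a * b) u.
Proof. by apply: addcharP => i /=; rewrite mulrA. Qed.
Let addchar1Z : left_id 1 addcharZ.
Proof. by move=> u; apply: addcharP => i /=; rewrite mul1r. Qed.
Let addcharZDr : right_distributive addcharZ +%R.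
Proof. by move=> a u v; apply: addcharP => i /=; rewrite mulrDr. Qed.
Let addcharZDl u : {morph addcharZ^~ u : a b / a + b}.
Proof. by move=> a b; apply: addcharP => i /=; rewrite mulrDl. Qed.
HB.instance Definition _ := GRing.Zmodule_isLmodule.Build k addchar
  addcharZA addchar1Z addcharZDr addcharZDl.

End Characters.

Section Derivations.
Variables (k : comNzRingType) (B : kcategory k).

Record derivation := Derivation {
  der_fun :> forall c b : B, hom c b -> hom c b;
  der_linear : forall c b, linear (@der_fun c b);
  derM : forall d c b (g : hom d c) (f : hom c b),
    der_fun (g \c f) = g \c der_fun f + der_fun g \c f
}.

Lemma derivationP (D E : derivation) :
  (forall c b (f : hom c b), D c b f = E c b f) -> D = E.
Proof.
case: D E => [D Dl DM] [E El EM] /= DE.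
have {}DE : D = E.
  apply: functional_extensionality_dep => c.
  by apply: functional_extensionality_dep => b; apply/funext => f.
by subst E; congr Derivation; exact: Prop_irrelevance.
Qed.

HB.instance Definition _ := gen_eqMixin derivation.
HB.instance Definition _ := gen_choiceMixin derivation.

Definition der0 : derivation.
Proof.
exists (fun c b f => 0).
- by move=> c b a f g; rewrite scaler0 addr0.
- by move=> d c b g f; rewrite kcomp0l kcomp0r addr0.
Defined.
Definition derN (D : derivation) : derivation.
Proof.
exists (fun c b f => - D c b f).
- by move=> c b a f g; rewrite der_linear opprD scalerN.
- by move=> d c b g f; rewrite derM kcompNl kcompNr opprD.
Defined.
Definition derD (D E : derivation) : derivation.
Proof.
exists (fun c b f => D c b f + E c b f).
- by move=> c b a f g; rewrite !der_linear scalerDr addrACA.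
- by move=> d c b g f; rewrite !derM kcompDl kcompDr addrACA.
Defined.
Definition derZ (a : k) (D : derivation) : derivation.
Proof.
exists (fun c b f => a *: D c b f).
- by move=> c b a' f g; rewrite der_linear scalerDr !scalerA mulrC.
- by move=> d c b g f; rewrite derM kcompZl kcompZr scalerDr.
Defined.

Let derDA : associative derD.
Proof. by move=> u v w; apply: derivationP => c b f /=; rewrite addrA. Qed.
Let derDC : commutative derD.
Proof. by move=> u v; apply: derivationP => c b f /=; rewrite addrC. Qed.
Let der0D : left_id der0 derD.
Proof. by move=> u; apply: derivationP => c b f /=; rewrite add0r. Qed.
Let derND : left_inverse der0 derN derD.
Proof. by move=> u; apply: derivationP => c b f /=; rewrite addNr. Qed.
HB.instance Definition _ :=
  GRing.isZmodule.Build derivation derDA derDC der0D derND.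

Let derZA a b u : derZ a (derZ b u) = derZ (a * b) u.
Proof. by apply: derivationP => i j f /=; rewrite scalerA. Qed.
Let der1Z : left_id 1 derZ.
Proof. by move=> u; apply: derivationP => i j f /=; rewrite scale1r. Qed.
Let derZDr : right_distributive derZ +%R.
Proof. by move=> a u v; apply: derivationP => i j f /=; rewrite scalerDr. Qed.
Let derZDl u : {morph derZ^~ u : a b / a + b}.
Proof. by move=> a b; apply: derivationP => i j f /=; rewrite scalerDl. Qed.
HB.instance Definition _ := GRing.Zmodule_isLmodule.Build k derivation
  derZA der1Z derZDr derZDl.

Definition inner_der (D : derivation) : Prop :=
  exists alpha : forall b : B, hom b b,
    forall c b (f : hom c b), D c b f = alpha c \c f - f \c alpha b.

Definition inner : {pred derivation} := fun D => `[< inner_der D >].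

Lemma inner_submod : GRing.submod_closed inner.
Proof.
split.
  apply/asboolP; exists (fun=> 0) => c b f.
  by rewrite kcomp0l kcomp0r subr0.
move=> a D E /asboolP[al Dal] /asboolP[be Ebe]; apply/asboolP.
exists (fun b => a *: al b + be b) => c b f /=.
rewrite Dal Ebe kcompDl kcompDr kcompZl kcompZr scalerBr.
by rewrite opprD addrACA.
Qed.
HB.instance Definition _ :=
  GRing.isSubmodClosed.Build k derivation inner inner_submod.

Local Open Scope quotient_scope.

Definition HH1 := Quotient.quot inner.
HB.instance Definition _ := Choice.on HH1.
HB.instance Definition _ := GRing.Zmodule.on HH1.

Definition der_class (D : derivation) : HH1 := \pi_(Quotient.quot inner) D.

Lemma der_class_eq D E : der_class D = der_class E <-> inner_der (D - E).
Proof.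
split=> [/eqP|/asboolP DE]; rewrite /der_class.
  by rewrite -Quotient.idealrBE => /asboolP.
by apply/eqP; rewrite -Quotient.idealrBE.
Qed.

Lemma der_class_surj (h : HH1) : exists D, der_class D = h.
Proof. by exists (repr (h : Quotient.quot inner)); rewrite /der_class reprK. Qed.

Lemma der_class_zmod : zmod_morphism der_class.
Proof. exact: (raddfB \pi_(Quotient.quot inner)). Qed.

Definition HH1_scale (a : k) (h : HH1) : HH1 :=
  der_class (a *: repr (h : Quotient.quot inner)).

Lemma der_classZ a D : der_class (a *: D) = HH1_scale a (der_class D).
Proof.
apply/der_class_eq; rewrite -scalerBr.
set D' := repr _.
have /der_class_eq DE : der_class D = der_class D' by rewrite /der_class reprK.
have /(rpredZ a) : D - D' \in inner by apply/asboolP.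
by move/asboolP.
Qed.

Let HH1_scaleA a b h : HH1_scale a (HH1_scale b h) = HH1_scale (a * b) h.
Proof. by have [D <-] := der_class_surj h; rewrite -!der_classZ scalerA. Qed.
Let HH1_scale1 : left_id 1 HH1_scale.
Proof. by move=> h; have [D <-] := der_class_surj h; rewrite -der_classZ scale1r. Qed.
Let der_classD D E : der_class (D + E) = der_class D + der_class E.
Proof. exact: (raddfD \pi_(Quotient.quot inner)). Qed.
Let HH1_scaleDr : right_distributive HH1_scale +%R.
Proof.
move=> a h l; have [D <-] := der_class_surj h; have [E <-] := der_class_surj l.
by rewrite -der_classD -!der_classZ scalerDr der_classD.
Qed.
Let HH1_scaleDl h : {morph HH1_scale^~ h : a b / a + b}.
Proof.
move=> a b; have [D <-] := der_class_surj h.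
by rewrite -!der_classZ scalerDl der_classD.
Qed.
HB.instance Definition _ := GRing.Zmodule_isLmodule.Build k HH1
  HH1_scaleA HH1_scale1 HH1_scaleDr HH1_scaleDl.

Lemma der_class_linear : linear der_class.
Proof. by move=> a D E; rewrite der_classD der_classZ. Qed.
HB.instance Definition _ :=
  GRing.isLinear.Build k derivation HH1 *:%R der_class der_class_linear.

End Derivations.

Section Canonical.
Variables (k : comNzRingType) (C B : kcategory k) (F : kfunctor C B).

Definition hom_cast (y y' x x' : B) (ey : y = y') (ex : x = x') (f : hom y x) :
  hom y' x' := ecast z (hom y' z) ex (ecast z (hom z x) ey f).

Variables (x : B -> C) (xK : cancel x F).

(* The cast turns morphisms [F (x b) -> F (s (x c))] into morphisms [b -> c]. *)
Definition Zset (s : Aut1 F) (c b : B) : set (hom c b) :=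
  [set hom_cast (etrans (aut1_fibre s (x c)) (xK c)) (xK b) (fmap F g)
     | g in [set: hom (s (x c)) (x b)]].

Definition Zdecomposition : Prop := forall (c b : B) (f : hom c b),
  exists! u : dsum (fun _ : Aut1 F => hom c b),
    (forall s, Zset s (u s)) /\ f = \sum_(s \in [set: Aut1 F]) u s.

Definition char_derivation (chi : addchar k (Aut1 F)) (D : derivation B) : Prop :=
  forall s c b (f : hom c b), Zset s f -> D c b f = chi s *: f.

End Canonical.

(* [Delta chi] is the class of the derivation attached to [chi], for every
   choice of objects in the fibres. *)
Definition canonical_map (k : comNzRingType) (C B : kcategory k)
    (F : kfunctor C B) (Delta : addchar k (Aut1 F) -> HH1 B) : Prop :=
  forall (x : B -> C) (xK : cancel x F),
    Zdecomposition xK /\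
    forall chi : addchar k (Aut1 F),
      exists D : derivation B,
        unique (char_derivation xK chi) D /\ Delta chi = der_class D.

(* Main.v *)
From HB Require Import structures.
From mathcomp Require Import all_boot all_algebra.
From mathcomp Require Import finmap boolp classical_sets functions cardinality.
From mathcomp Require Import fsbigop.
Require Import Defs.
Import GRing.Theory.
Local Open Scope ring_scope.

Set Implicit Arguments.
Unset Strict Implicit.
Unset Printing Implicit Defensive.

(** The derivation attached to a character [chi] of [Aut1 F] descends from an
    inner derivation upstairs.  Call [phi : C -> k] equivariant for [chi] when
    [phi (s y) = chi s + phi y]; such a weight exists because [Aut1 F] acts
    simply transitively on every fibre ([aut_trans], [aut_free]): after choosing
    a base point in each fibre, put [phi y = chi s] if [s] carries the base
    point to [y].  Multiplying each [g : z -> y] of [C] by [phi y - phi z] is a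
    derivation of [C] commuting with [Aut1 F].  Since [F] is a covering, every
    morphism of [B] is a finite sum of images of morphisms of [C] with a
    prescribed source, uniquely so once that source is fixed, and changing the
    source inside its fibre amounts to applying an element of [Aut1 F].  Hence
    there is exactly one derivation [D] of [B] with
    [D (F g) = (phi y - phi z) *: F g] for all [g] ([graded_der_exists]).

    On the base points [phi] vanishes, so [D] is multiplication by [chi s] on
    [Zset s], that is, the derivation in the definition of the canonical map.
    Two weights equivariant for the same [chi] differ by a function constant on
    the fibres, hence by a function on the objects of [B], whose associated
    derivation is inner: the class of [D] does not depend on the base points
    ([graded_der_cohomologous]).

    For injectivity, let [D] be inner.  Endomorphism rings being reduced to [k],
    [D f = (a c - a b) *: f] for some function [a] on the objects of [B].
    Comparing on [F g] with [g] nonzero, [phi y - a (F y)] takes the same value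
    at the two ends of each nonzero morphism of [C], so it is constant because
    [C] is connected; comparing its values at [y] and [s y] gives [chi s = 0].

    Freeness and transitivity of the action come from the existence and the
    uniqueness of lifts ([side_lift], [side_inj]), used at the source or at the
    target.  To compare morphisms whose
    endpoints are equal but not convertible (as [F (s y)] and [F y]), all the
    morphisms of a category are embedded into the direct sum [total] of its
    morphism modules, on which functors act linearly. *)

(** * Direct sums *)

Section DirectSumTheory.
Local Open Scope classical_set_scope.
Variables (k : comNzRingType) (I : choiceType) (M : I -> lmodType k).

Lemma dsum_sumE (T : Type) (r : seq T) (G : T -> dsum M) i :
  (\sum_(j <- r) G j) i = \sum_(j <- r) G j i.
Proof. exact: (big_morph (fun u : dsum M => u i)). Qed.

Lemma dsum_in_eq i (m : M i) : dsum_in m i = m.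
Proof. by rewrite /= dfwith_in. Qed.

Lemma dsum_in_neq i j (m : M i) : i != j -> dsum_in m j = 0.
Proof. by move=> ij; rewrite /= dfwith_out. Qed.

Lemma dsum_in_inj i : injective (@dsum_in k I M i).
Proof. by move=> m n mn; rewrite -(dsum_in_eq m) mn dsum_in_eq. Qed.

Lemma dsum_in_support i j (m : M i) : dsum_in m j != 0 -> i = j.
Proof. by apply: contra_neq_eq; exact: dsum_in_neq. Qed.

Lemma dsum_decomp (u : dsum M) :
  exists r : seq I, u = \sum_(i <- r) dsum_in (u i).
Proof.
exists (fset_set [set i | u i != 0]); apply: dsumP => j; rewrite dsum_sumE.
have [uj|uj] := boolP (j \in fset_set [set i | u i != 0]).
  rewrite (bigD1_seq j) ?fset_uniq// dsum_in_eq big1 => [|i ij].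
    by rewrite [RHS]addr0.
  by rewrite dsum_in_neq.
rewrite big_seq big1; last first.
  by move=> i iS; rewrite dsum_in_neq//; apply: contraNneq uj => <-.
apply/eqP; apply: contraNT uj => uj.
by rewrite in_fset_set ?inE//; exact: dsum_finite.
Qed.

Lemma dsum_ind (P : dsum M -> Prop) :
  P 0 -> (forall u v, P u -> P v -> P (u + v)) ->
  (forall i (m : M i), P (dsum_in m)) -> forall u, P u.
Proof.
move=> P0 PD Pin u; have [r ->] := dsum_decomp u.
by elim/big_ind: _ => // v w; exact: PD.
Qed.

Lemma dsum_linear_ext (V : lmodType k) (f g : {linear dsum M -> V}) :
  (forall i (m : M i), f (dsum_in m) = g (dsum_in m)) -> f =1 g.
Proof.
move=> fg; apply: dsum_ind => [|u v fu fv|]//; first by rewrite !linear0.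
by rewrite !linearD fu fv.
Qed.

Lemma dsum_map_in (J : choiceType) (N : J -> lmodType k) (h : I -> J)
    (g : forall i, {linear M i -> N (h i)}) i (m : M i) :
  dsum_map g (dsum_in m) = dsum_in (g i m).
Proof.
rewrite /dsum_map -(@fsbig_widen _ _ _ _ [set i])//; last first.
  move=> j [_ /eqP ij]; change (dsum_in (g j (dsum_in m j)) = 0).
  rewrite [dsum_in m j]dsum_in_neq ?linear0//.
  by rewrite eq_sym.
by rewrite fsbig_set1 dsum_in_eq.
Qed.

End DirectSumTheory.

(** Extending by zero along an injection of index sets, and restricting: this is
    what identifies half of a star with a submodule of [total]. *)
Section Reindex.
Local Open Scope classical_set_scope.
Variables (k : comNzRingType) (I : choiceType) (M : I -> lmodType k).
Variables (J : choiceType) (e : J -> I).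
Hypothesis e_inj : injective e.

Definition dsum_push : dsum (fun j => M (e j)) -> dsum M :=
  dsum_map (M := fun j => M (e j)) (N := M) (h := e) (fun j => idfun).
HB.instance Definition _ := GRing.Linear.on dsum_push.

Lemma dsum_push_in j (m : M (e j)) :
  dsum_push (@dsum_in k J (fun j => M (e j)) j m) = dsum_in m.
Proof. by rewrite /dsum_push dsum_map_in. Qed.

Lemma dsum_pull_finite (u : dsum M) : finite_set [set j | u (e j) != 0].
Proof.
apply: (@finite_preimage _ _ [set i | u i != 0] e); last exact: dsum_finite.
by move=> ? ? _ _; exact: e_inj.
Qed.

Definition dsum_pull u : dsum (fun j => M (e j)) := DSum (dsum_pull_finite u).

Lemma dsum_pushK : cancel dsum_push dsum_pull.
Proof.
move=> w; elim/dsum_ind: w => [|u v uK vK|j m]; apply: dsumP => i.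
- by rewrite /= linear0.
- by rewrite /= linearD /= -[in RHS]uK -[in RHS]vK.
- rewrite dsum_push_in.
  have [<-|ij] := eqVneq j i; first by rewrite /= !dfwith_in.
  rewrite (dsum_in_neq (M := fun j => M (e j)))//.
  by rewrite /= dfwith_out// (inj_eq e_inj).
Qed.

Lemma dsum_push_support w i : dsum_push w i != 0 -> exists j, e j = i.
Proof.
apply: contra_neqP => ei; elim/dsum_ind: w => [|u v u0 v0|j m].
- by rewrite linear0.
- by rewrite linearD /= u0 v0 addr0.
- rewrite dsum_push_in dsum_in_neq//.
  by apply/eqP => ji; apply: ei; exists j.
Qed.

Lemma dsum_pullK (u : dsum M) : (forall i, u i != 0 -> exists j, e j = i) ->
  dsum_push (dsum_pull u) = u.
Proof.
move=> ue; apply: dsumP => i.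
have [[j <-]|ei] := pselect (exists j, e j = i).
  exact: (congr1 (fun w : dsum _ => w j) (dsum_pushK (dsum_pull u))).
have out (v : dsum M) : (v i != 0 -> exists j, e j = i) -> v i = 0.
  by move=> vi; apply/eqP; apply: contra_notT ei.
by rewrite [LHS]out ?[RHS]out//; first exact: ue; exact: dsum_push_support.
Qed.

End Reindex.

Section Total.
Local Open Scope classical_set_scope.
Variables (k : comNzRingType) (I : choiceType) (V : lmodType k).
Implicit Types u : dsum (fun _ : I => V).

Definition dsum_total u : V := \sum_(i \in [set: I]) u i.

Lemma dsum_total_seq u : exists r : seq I,
  [/\ uniq r, forall i, u i != 0 -> i \in r & dsum_total u = \sum_(i <- r) u i].
Proof.
have fin := dsum_finite u.
exists (fset_set [set i | u i != 0]); split; first exact: fset_uniq.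
  by move=> i ui; rewrite in_fset_set// inE.
rewrite -fsbig_finite//; apply/esym/fsbig_widen => // i [_ /= /negP].
by rewrite negbK => /eqP.
Qed.

Lemma dsum_total_wide u (S : set I) : finite_set S ->
  (forall i, u i != 0 -> S i) -> dsum_total u = \sum_(i \in S) u i.
Proof.
move=> finS uS; apply/esym/fsbig_widen => // i [_ /= nSi].
by apply/eqP; apply: contra_notT nSi => /uS.
Qed.

Lemma dsum_total_linear : linear dsum_total.
Proof.
move=> a u v; pose S := [set i | u i != 0] `|` [set i | v i != 0].
have finS : finite_set S.
  by rewrite finite_setU; split; exact: dsum_finite.
rewrite !(@dsum_total_wide _ S)//; last 3 first.
- by move=> i vi; right.
- by move=> i ui; left.
- move=> i /=; have [ui|ui _] := eqVneq (u i) 0; last by left.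
  by rewrite ui scaler0 add0r; right.
by rewrite !fsbig_finite//= scaler_sumr -big_split.
Qed.
HB.instance Definition _ := GRing.isLinear.Build k
  (dsum (fun _ : I => V)) V *:%R dsum_total dsum_total_linear.

Lemma dsum_total_in i (m : V) :
  dsum_total (@dsum_in k I (fun _ => V) i m) = m.
Proof.
rewrite (@dsum_total_wide _ [set i])// => [|j /dsum_in_support <-//].
by rewrite fsbig_set1 dsum_in_eq.
Qed.

End Total.

(** * The module of all morphisms of a category *)
Section TotalModule.
Variable k : comNzRingType.

Definition arrow (C : kcategory k) (p : C * C) : lmodType k := hom p.1 p.2.
Definition total (C : kcategory k) := dsum (@arrow C).
Definition mor (C : kcategory k) (p : C * C) (f : hom p.1 p.2) : total C :=
  dsum_in (M := @arrow C) (i := p) f.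
HB.instance Definition _ (C : kcategory k) (p : C * C) :=
  GRing.Linear.copy (@mor C p) (@dsum_in k _ (@arrow C) p).

Section Map.
Variables (C B : kcategory k) (G : kfunctor C B).

Definition pmap (p : C * C) : B * B := (G p.1, G p.2).

Definition tmap : total C -> total B :=
  dsum_map (M := @arrow C) (N := @arrow B) (h := pmap)
    (fun p => @fmap k C B G p.1 p.2 : {linear _ -> _}).
HB.instance Definition _ := GRing.Linear.on tmap.

Lemma tmap_mor p (f : hom p.1 p.2) :
  tmap (mor f) = mor (p := pmap p) (fmap G f).
Proof. by rewrite /tmap dsum_map_in. Qed.

Lemma tmap_sumE u q : exists r : seq (C * C),
  tmap u q = \sum_(p <- r) mor (p := pmap p) (fmap G (u p)) q.
Proof.
have [r {1}->] := dsum_decomp u; exists r.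
by rewrite linear_sum dsum_sumE; apply: eq_bigr => p _; rewrite -tmap_mor.
Qed.

Lemma tmap_support u q : tmap u q != 0 -> exists2 p, u p != 0 & pmap p = q.
Proof.
have [r ->] := tmap_sumE u q.
apply: contra_neqP => nex; rewrite big1// => p _.
have [up|up] := eqVneq (u p) 0; first by rewrite up !linear0.
by rewrite [LHS]dsum_in_neq//; apply/eqP => pq; apply: nex; exists p.
Qed.

End Map.

Lemma tmap_id (C : kcategory k) (u : total C) : tmap (kfid C) u = u.
Proof.
move: u; apply: (dsum_linear_ext (g := idfun)) => -[y x] f.
exact: (@tmap_mor C C (kfid C) (y, x) f).
Qed.

Lemma tmap_comp (C B A : kcategory k) (G : kfunctor B A) (F : kfunctor C B)
    (u : total C) : tmap (kfcomp G F) u = tmap G (tmap F u).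
Proof.
move: u; apply: (dsum_linear_ext (g := tmap G \o tmap F)) => p f /=.
by rewrite !tmap_mor.
Qed.

(** The equation between morphisms is stated in [total] because, before the
    object parts are identified, the two sides have different types. *)
Lemma kfunctor_ext (C B : kcategory k) (G H : kfunctor C B) :
  G =1 H ->
  (forall p (f : hom p.1 p.2), tmap G (mor f) = tmap H (mor f)) -> G = H.
Proof.
case: G H => [o m l1 u1 c1] [o' m' l2 u2 c2] /= /funext oo; subst o' => mm.
suff mE : m = m' by subst m'; exact: kfunctor_eq.
apply: functional_extensionality_dep => y.
apply: functional_extensionality_dep => x; apply/funext => f.
move: (mm (y, x) f); rewrite !tmap_mor /=.
exact: dsum_in_inj.
Qed.

End TotalModule.

(** * Lifting through a covering, and the action of the automorphism group *)
Section Sides.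
Variables (k : comNzRingType) (C B : kcategory k) (F : kfunctor C B).

(** A pair [(y, x)] stands for a morphism from [x] to [y].  The boolean selects
    the half of the star: [true] for the morphisms out of the base point [x],
    [false] for those into it, so that both halves are treated at once. *)
Definition base (T : Type) (e : bool) (p : T * T) : T := if e then p.2 else p.1.
Definition tip (T : Type) (e : bool) (p : T * T) : T := if e then p.1 else p.2.
Definition on_side (e : bool) (x : C) (u : total C) : Prop :=
  forall p, u p != 0 -> base e p = x.

Definition column (A : kcategory k) (x : A) (w : dsum (fun y : A => hom y x)) :
  total A := dsum_push (M := @arrow k A) (e := fun y => (y, x)) w.
Definition row (A : kcategory k) (x : A) (w : dsum (fun y : A => hom x y)) :
  total A := dsum_push (M := @arrow k A) (e := fun y => (x, y)) w.
Lemma column_linear A x : linear (@column A x).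
Proof. exact: (linearP (@dsum_push k _ (@arrow k A) _ (fun y => (y, x)))). Qed.
Lemma row_linear A x : linear (@row A x).
Proof. exact: (linearP (@dsum_push k _ (@arrow k A) _ (fun y => (x, y)))). Qed.
HB.instance Definition _ (A : kcategory k) (x : A) :=
  GRing.isLinear.Build k (dsum (fun y : A => hom y x)) (total A) *:%R
    (@column A x) (@column_linear A x).
HB.instance Definition _ (A : kcategory k) (x : A) :=
  GRing.isLinear.Build k (dsum (fun y : A => hom x y)) (total A) *:%R
    (@row A x) (@row_linear A x).

Lemma column_index_inj (T : Type) (x : T) : injective (fun y : T => (y, x)).
Proof. by move=> y z []. Qed.

Lemma row_index_inj (T : Type) (x : T) : injective (fun y : T => (x, y)).
Proof. by move=> y z []. Qed.

Definition star_column (x : C) := dsum_map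
  (N := fun y => hom y (F x)) (fun y => @fmap k C B F y x : {linear _ -> _}).
Definition star_row (x : C) := dsum_map
  (N := fun y => hom (F x) y) (fun y => @fmap k C B F x y : {linear _ -> _}).
HB.instance Definition _ x := GRing.Linear.on (@star_column x).
HB.instance Definition _ x := GRing.Linear.on (@star_row x).

Lemma tmap_column x w : tmap F (@column C x w) = column (star_column w).
Proof.
move: w; apply: (dsum_linear_ext (f := tmap F \o @column C x)
  (g := @column B (F x) \o @star_column x)) => y f /=.
rewrite /column /star_column dsum_map_in.
rewrite (dsum_push_in (M := @arrow k C) (e := fun y => (y, x))).
rewrite (dsum_push_in (M := @arrow k B) (e := fun y => (y, F x))).
exact: (@tmap_mor k C B F (y, x)).
Qed.

Lemma tmap_row x w : tmap F (@row C x w) = row (star_row w).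
Proof.
move: w; apply: (dsum_linear_ext (f := tmap F \o @row C x)
  (g := @row B (F x) \o @star_row x)) => y f /=.
rewrite /row /star_row dsum_map_in.
rewrite (dsum_push_in (M := @arrow k C) (e := fun y => (x, y))).
rewrite (dsum_push_in (M := @arrow k B) (e := fun y => (F x, y))).
exact: (@tmap_mor k C B F (x, y)).
Qed.

Hypothesis covF : covering F.

(** Lifts with a prescribed source (or target) are unique, and they exist by
    [side_lift]: these are the two halves of the bijectivity of [star_map]. *)
Lemma side_inj e x u : on_side e x u -> tmap F u = 0 -> u = 0.
Proof.
have [_ /(_ x) /bij_inj sinj] := covF.
case: e => ux Fu0.
- have uE : column (dsum_pull (@column_index_inj C x) u) = u.
    by apply: dsum_pullK => -[y z] /ux /= ->; exists y.
  rewrite -uE tmap_column -[0](linear0 (@column B (F x))) in Fu0.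
  have /= Fw0 := can_inj (dsum_pushK (@column_index_inj B (F x))) Fu0.
  rewrite -uE; set w := dsum_pull _ _ in Fw0 *.
  suff : (w, 0 : dsum (fun y => hom x y)) = 0.
    by move=> /(congr1 fst) /= ->; rewrite linear0.
  apply: sinj; rewrite linear0; congr (_, _); first exact: Fw0.
  exact: (linear0 (@star_row x)).
- have uE : row (dsum_pull (@row_index_inj C x) u) = u.
    by apply: dsum_pullK => -[y z] /ux /= ->; exists z.
  rewrite -uE tmap_row -[0](linear0 (@row B (F x))) in Fu0.
  have /= Fw0 := can_inj (dsum_pushK (@row_index_inj B (F x))) Fu0.
  rewrite -uE; set w := dsum_pull _ _ in Fw0 *.
  suff : (0 : dsum (fun y => hom y x), w) = 0.
    by move=> /(congr1 snd) /= ->; rewrite linear0.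
  apply: sinj; rewrite linear0; congr (_, _); last exact: Fw0.
  exact: (linear0 (@star_column x)).
Qed.

Lemma side_lift e x (q : B * B) (f : hom q.1 q.2) : base e q = F x ->
  exists2 u, on_side e x u & tmap F u = mor f.
Proof.
have [_ /(_ x) [g _ gK]] := covF.
case: e q f => -[c b] f /= bE; subst.
- pose f' : dsum (fun y : B => hom y (F x)) :=
    @dsum_in k B (fun y : B => hom y (F x)) c f.
  have /(congr1 fst) /= wE := gK (f', 0).
  exists (column (g (f', 0)).1).
    by move=> p /dsum_push_support [y <-].
  rewrite tmap_column [star_column _]wE.
  exact: (dsum_push_in (M := @arrow k B) (e := fun y => (y, F x))).
- pose f' : dsum (fun y : B => hom (F x) y) :=
    @dsum_in k B (fun y : B => hom (F x) y) b f.
  have /(congr1 snd) /= wE := gK (0, f').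
  exists (row (g (0, f')).2).
    by move=> p /dsum_push_support [y <-].
  rewrite tmap_row [star_row _]wE.
  exact: (dsum_push_in (M := @arrow k B) (e := fun y => (F x, y))).
Qed.

Lemma on_side0 e x : on_side e x (0 : total C).
Proof. by move=> p /=; rewrite eqxx. Qed.

Lemma on_sideD e x (u v : total C) :
  on_side e x u -> on_side e x v -> on_side e x (u + v).
Proof.
move=> ux vx p /=; have [->|/ux //] := eqVneq (u p) 0.
by rewrite add0r; exact: vx.
Qed.

Lemma on_sideB e x (u v : total C) :
  on_side e x u -> on_side e x v -> on_side e x (u - v).
Proof.
move=> ux vx; apply: on_sideD => // p /=; rewrite oppr_eq0; exact: vx.
Qed.

Lemma on_side_mor e p (f : hom p.1 p.2) :
  on_side e (base e p) (mor f : total C).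
Proof. by move=> q /dsum_in_support ->. Qed.

Arguments on_side_mor e [p] f _ _.

(** This is how surjectivity on stars is used: a morphism with one end [F x] is
    a finite sum of images of morphisms of [C] with that end at [x], and only
    those with the right other end [q] contribute. *)
Lemma lift_ind e x (q : B * B) (P : hom q.1 q.2 -> Prop) : base e q = F x ->
  P 0 -> (forall f g, P f -> P g -> P (f + g)) ->
  (forall p (g : hom p.1 p.2) (f : hom q.1 q.2), base e p = x -> pmap F p = q ->
     tmap F (mor g) = mor f -> P f) ->
  forall f, P f.
Proof.
move=> qx P0 PD Pgen f; have [u ux uf] := side_lift f qx.
have -> : f = tmap F u q by rewrite uf /mor dsum_in_eq.
have [r ->] := tmap_sumE F u q; elim/big_ind: _ => // p _.
have [up0|/ux px] := eqVneq (u p) 0; first by rewrite up0 !linear0.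
have [pq|pq] := eqVneq (pmap F p) q; last by rewrite /mor dsum_in_neq.
apply: (Pgen p (u p)) => //; rewrite tmap_mor.
by case: q / pq {qx P P0 PD Pgen f uf}; rewrite {2}/mor dsum_in_eq.
Qed.

Lemma tmap_aut (s : Aut1 F) u : tmap F (tmap s u) = tmap F u.
Proof. by rewrite -tmap_comp aut_over. Qed.

Lemma aut1K (s : Aut1 F) : cancel s (s^-1)%g.
Proof.
exact: (fun x => congr1 (fun G : kfunctor C C => G x) (aut_invl s)).
Qed.

Lemma on_side_aut e x u (s : Aut1 F) :
  on_side e x u -> on_side e (s x) (tmap s u).
Proof. by move=> ux q /tmap_support[p /ux <- <-]; case: (e). Qed.

Lemma side_eq e x u v : on_side e x u -> on_side e x v ->
  tmap F u = tmap F v -> u = v.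
Proof.
move=> ux vx /eqP; rewrite -subr_eq0 -linearB => /eqP uv.
by apply/eqP; rewrite -subr_eq0; apply/eqP/(side_inj (on_sideB ux vx)).
Qed.

(** An automorphism over [B] that fixes [x] fixes every morphism at [x], since
    a morphism and its image are two lifts of the same morphism at [x]. *)
Lemma tmap_fix e x u (s : Aut1 F) : s x = x -> on_side e x u -> tmap s u = u.
Proof.
move=> sx ux; apply: (side_eq _ ux); last exact: tmap_aut.
by rewrite -{1}sx; exact: on_side_aut.
Qed.

Hypothesis connC : kconnected C.

Lemma connected_ind (Q : C -> Prop) :
  (forall e p (f : hom p.1 p.2), f != 0 -> Q (base e p) -> Q (tip e p)) ->
  forall x y, Q x -> Q y.
Proof.
move=> step x y; have [r [xr <-]] := connC x y.
elim: r x xr => //= z r IH x /andP[/asboolP xz zr] Qx; apply: IH => //.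
case: xz => -[f f0].
- exact: (step true (z, x) f f0).
- exact: (step false (x, z) f f0).
Qed.

(** The objects fixed by [s] form a set closed under linkage by [tmap_fix], as a
    nonzero morphism determines its two ends. *)
Lemma aut_free (s : Aut1 F) x : s x = x -> s = 1%g.
Proof.
move=> sx; have sid : s =1 id.
  move=> y; move: x y sx; apply: connected_ind => e p f f0 sb.
  have /(congr1 (fun u : total C => u p)) := tmap_fix sb (on_side_mor e f).
  rewrite tmap_mor /mor dsum_in_eq => sf.
  have /dsum_in_support/(congr1 (tip e)) :
    dsum_in (M := @arrow k C) (i := pmap s p) (fmap s f) p != 0 by rewrite sf.
  by case: (e).
apply: Aut1P; apply: kfunctor_ext => // p f.
by rewrite (tmap_fix (e := true) (sid _) (on_side_mor true f)) tmap_id.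
Qed.

Lemma aut_inj (s t : Aut1 F) x : s x = t x -> s = t.
Proof.
move=> st; apply: (mulgI (t^-1)%g); rewrite mulVg.
by apply: (@aut_free _ x); rewrite /= st; exact: aut1K.
Qed.

(** Transitivity passes from the fibre of one end [x] of a nonzero [f] to the
    fibre of the other end.  Given [y] in the latter fibre, lift [F f] at [y]
    instead; the components of the lift can be moved by automorphisms so that
    they all have [x] as an end, the other end then being in the orbit of [y].
    Their sum lifts [F f] at [x], so it is [f], and the other end of [f] must
    lie in the orbit of [y]. *)
Lemma aut_trans_step e p (f : hom p.1 p.2) : f != 0 ->
  (forall y : C, F y = F (base e p) -> exists s : Aut1 F, s (base e p) = y) ->
  forall y : C, F y = F (tip e p) -> exists s : Aut1 F, s (tip e p) = y.
Proof.
move=> f0 Qp y Fy; set x := base e p in Qp.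
(* [P h]: [h] has a lift at [x] whose components join [x] to the orbit
   of [y]. *)
pose P (h : hom (F p.1) (F p.2)) := exists w : total C, [/\ on_side e x w,
  (forall r, w r != 0 -> exists s : Aut1 F, s y = tip e r) &
  tmap F w = mor (p := pmap F p) h].
have [|||r g h ry rp gh|w [wx wy wf]] :=
  @lift_ind (~~ e) y (pmap F p) P _ _ _ _ (fmap F f).
- by rewrite Fy; case: (e).
- exists 0; split; [exact: on_side0| |by rewrite !linear0].
  by move=> r /=; rewrite eqxx.
- move=> h1 h2 [w1 [w1x w1y w1h]] [w2 [w2x w2y w2h]]; exists (w1 + w2).
  split; [exact: on_sideD| |by rewrite !linearD /= w1h w2h].
  move=> r /=; have [->|/w1y //] := eqVneq (w1 r) 0.
  by rewrite add0r; exact: w2y.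
- have [s sx] : exists s : Aut1 F, s x = base e r.
    by apply: Qp; move: (congr1 (base e) rp); rewrite /x; case: (e).
  exists (tmap (s^-1)%g (mor g)); split; last by rewrite tmap_aut.
    rewrite -[x](aut1K s) sx; exact: on_side_aut (on_side_mor e g).
  move=> q; rewrite tmap_mor => /dsum_in_support <-; exists (s^-1)%g.
  by rewrite -ry; case: (e).
have wE : w = mor f.
  by apply: side_eq wx (on_side_mor e f) _; rewrite wf tmap_mor.
have [|s sy] := wy p; first by rewrite wE /mor dsum_in_eq.
by exists (s^-1)%g; rewrite -sy; exact: aut1K.
Qed.

End Sides.

(** * Derivations given by weights on the objects of a Galois covering *)
Section Galois.
Variables (k : comNzRingType) (C B : kcategory k) (F : kfunctor C B).
Hypothesis galF : galois_covering F.

Let covF : covering F. Proof. by case: galF. Qed.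
Let connC : kconnected C. Proof. by case: galF. Qed.

Lemma aut_trans (x y : C) : F x = F y -> exists s : Aut1 F, s x = y.
Proof.
have [_ _ [b trb]] := galF; have [x0 Fx0] := covF.1 b.
move=> xy; pose Q x := forall y, F y = F x -> exists s : Aut1 F, s x = y.
have Qx0 : Q x0 by move=> z; rewrite Fx0 => Fz; exact: trb.
suff: Q x by apply.
apply: (connected_ind connC _ x Qx0) => e p f f0 Qp.
exact: (aut_trans_step covF f0).
Qed.

Lemma fmap_eq0 p (g : @hom k C p.1 p.2) : fmap F g = 0 -> g = 0.
Proof.
move=> Fg0; apply: (@dsum_in_inj k _ (@arrow k C) p); rewrite linear0.
apply: (side_inj covF (@on_side_mor _ _ true p g)).
by rewrite tmap_mor Fg0 linear0.
Qed.

Lemma hom_ind (z : C) (P : forall c, hom c (F z) -> Prop) :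
  (forall c, P c 0) -> (forall c f g, P c f -> P c g -> P c (f + g)) ->
  (forall y (g : hom y z), P (F y) (fmap F g)) -> forall c f, P c f.
Proof.
move=> P0 PD Pgen c; apply: (@lift_ind _ _ _ _ covF true z (c, F z)) => //=.
- by move=> f g; exact: PD.
- move=> [y z'] /= g f zz; subst z' => -[yc]; subst c.
  by rewrite tmap_mor => /dsum_in_inj <-; exact: Pgen.
Qed.

HB.instance Definition _ (D : derivation B) c b :=
  GRing.isLinear.Build k (hom c b) (hom c b) *:%R
    (D c b) (@der_linear k B D c b).

(** [D] is induced through [F] by the inner derivation of [C] associated with
    the multiples [phi y *: kid y] of the identities. *)
Definition graded_der (phi : C -> k) (D : derivation B) : Prop :=
  forall y z (g : @hom k C y z),
    D (F y) (F z) (fmap F g) = (phi y - phi z) *: fmap F g.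

Lemma derivation_ext (D E : derivation B) :
  (forall y z (g : @hom k C y z), D _ _ (fmap F g) = E _ _ (fmap F g)) -> D = E.
Proof.
move=> DE; apply: derivationP => c b f; have [z zb] := covF.1 b; subst b.
move: c f; apply: hom_ind => [c|c f g Df Dg|y g]; first by rewrite !linear0.
  by rewrite !linearD /= Df Dg.
exact: DE.
Qed.

Lemma graded_der_uniq phi D E : graded_der phi D -> graded_der phi E -> D = E.
Proof.
by move=> Dphi Ephi; apply: derivation_ext => y z g; rewrite Dphi Ephi.
Qed.

Lemma graded_der_mor phi D (p : C * C) (g : hom p.1 p.2) (q : B * B)
    (f : hom q.1 q.2) : graded_der phi D -> pmap F p = q ->
  tmap F (mor g) = mor f -> D q.1 q.2 f = (phi p.1 - phi p.2) *: f.
Proof.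
move=> Dphi pq; subst q; rewrite tmap_mor => /dsum_in_inj <-; exact: Dphi.
Qed.

Definition scale_by (phi : C -> k) : total C -> total C :=
  dsum_map (M := @arrow k C) (N := @arrow k C) (h := id)
    (fun p => GRing.scale (phi p.1 - phi p.2) : {linear _ -> _}).
HB.instance Definition _ phi := GRing.Linear.on (scale_by phi).

Lemma scale_by_mor phi p (f : @hom k C p.1 p.2) :
  scale_by phi (mor f) = mor ((phi p.1 - phi p.2) *: f).
Proof. by rewrite /scale_by dsum_map_in. Qed.

Definition equivariant (chi : addchar k (Aut1 F)) (phi : C -> k) : Prop :=
  forall (s : Aut1 F) y, phi (s y) = chi s + phi y.

Section Equivariant.
Variables (chi : addchar k (Aut1 F)) (phi : C -> k).
Hypothesis phi_equiv : equivariant chi phi.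

Lemma scale_by_aut (s : Aut1 F) u :
  scale_by phi (tmap s u) = tmap s (scale_by phi u).
Proof.
move: u; apply: (dsum_linear_ext (f := scale_by phi \o tmap s)
  (g := tmap s \o scale_by phi)) => p f /=.
rewrite -/(mor f) scale_by_mor !tmap_mor scale_by_mor /=.
by rewrite !phi_equiv opprD addrACA subrr add0r [in RHS]linearZ.
Qed.

(** Two lifts of the same element at two points of a fibre are exchanged by some
    [s], and scaling by an equivariant weight commutes with [s]. *)
Lemma scale_by_lift x z u v : on_side true x u -> on_side true z v ->
  F x = F z -> tmap F u = tmap F v ->
  tmap F (scale_by phi u) = tmap F (scale_by phi v).
Proof.
move=> ux vz /aut_trans[s sx] uv.
have <- : tmap s u = v.
  apply: (side_eq covF _ vz); last by rewrite tmap_aut.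
  by rewrite -sx; exact: on_side_aut.
by rewrite scale_by_aut tmap_aut.
Qed.

(** The value at [f] is the image of the scaled lift of [f]; by [scale_by_lift]
    it can be computed from a lift at any point of the fibre.  The Leibniz rule
    is checked on composites [F g \c F f] with [g \c f] defined in [C]: such
    pairs suffice, lifting [f] first and then [g] at the target of the lift. *)
Lemma graded_der_exists : exists D, graded_der phi D.
Proof.
have [x xK] := choice covF.1.
have liftX c b (f : hom c b) : exists u,
    on_side true (x b) u /\ tmap F u = mor (p := (c, b)) f.
  by have [|u] := @side_lift _ _ _ _ covF true (x b) (c, b) f; [|exists u].
pose D c b (f : hom c b) : hom c b :=
  tmap F (scale_by phi (projT1 (cid (liftX c b f)))) (c, b).
have DE c b (f : hom c b) z u : F z = b -> on_side true z u ->
    tmap F u = mor (p := (c, b)) f -> D c b f = tmap F (scale_by phi u) (c, b).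
  move=> zb uz uf; rewrite /D; case: cid => v [/= vx vf].
  by rewrite (scale_by_lift vx uz) ?uf// xK zb.
have DF y z (g : @hom k C y z) :
    D (F y) (F z) (fmap F g) = (phi y - phi z) *: fmap F g.
  rewrite (DE _ _ _ z (mor (p := (y, z)) g))//; last 2 first.
  - exact: (@on_side_mor _ _ true (y, z)).
  - exact: tmap_mor.
  rewrite scale_by_mor tmap_mor /mor dsum_in_eq; exact: linearZ.
have Dlin c b : linear (@D c b).
  move=> a f g.
  have [u [ux uf]] := liftX _ _ f; have [v [vx vg]] := liftX _ _ g.
  rewrite (DE _ _ _ _ _ (xK b) ux uf) (DE _ _ _ _ _ (xK b) vx vg).
  rewrite (DE _ _ _ (x b) (a *: u + v))//.
  - by rewrite !linearP.
  - by apply: on_sideD => // p /=; have [->|/ux //] := eqVneq (u p) 0;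
      rewrite scaler0 eqxx.
  - by rewrite linearP /= uf vg -linearP.
pose DL c b : {linear hom c b -> hom c b} :=
  HB.pack (@D c b) (GRing.isLinear.Build k _ _ *:%R (@D c b) (@Dlin c b)).
have D0 c b : @D c b 0 = 0 by exact: (linear0 (DL c b)).
have DD c b f g : @D c b (f + g) = D c b f + D c b g.
  exact: (linearD (DL c b)).
have DM d c b (g : hom d c) (f : hom c b) :
    D _ _ (g \c f) = g \c D _ _ f + D _ _ g \c f.
  have [z zb] := covF.1 b; subst b; move: c f d g.
  apply: hom_ind => [c|c f1 f2 D1 D2|y f] d g.
  - by rewrite kcomp0r !D0 !kcomp0r addr0.
  - rewrite kcompDr !DD D1 D2 !kcompDr.
    by rewrite addrACA.
  move: d g; apply: hom_ind => [d|d g1 g2 D1 D2|w g].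
  - by rewrite kcomp0l !D0 !kcomp0l addr0.
  - rewrite kcompDl !DD D1 D2 !kcompDl.
    by rewrite addrACA.
  rewrite -fmapM !DF kcompZr kcompZl -scalerDl fmapM.
  by rewrite [in RHS]addrC addrA subrK.
by exists (Derivation Dlin DM).
Qed.

End Equivariant.

(** * The decomposition attached to a choice of base points *)
Section Fibres.
Variables (x : B -> C) (xK : cancel x F).

(** Evaluating [chi] at an automorphism carrying the base point to [y] gives a
    weight that is also linear in [chi]; this makes [Delta] linear. *)
Lemma weight_exists : exists phi : addchar k (Aut1 F) -> C -> k,
  [/\ forall chi, equivariant chi (phi chi),
      forall chi b, phi chi (x b) = 0 &
      forall a chi psi y, phi (a *: chi + psi) y = a * phi chi y + phi psi y].
Proof.
have /choice[sigma sigmaP] : forall y, exists s : Aut1 F, s (x (F y)) = y.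
  by move=> y; apply: aut_trans; rewrite xK.
exists (fun chi y => chi (sigma y)); split=> //= chi.
- move=> s y; rewrite -addcharM; congr (chi _).
  apply: (aut_inj covF connC (x := x (F y))).
  by rewrite -[in LHS](aut1_fibre s y) sigmaP /= sigmaP.
- move=> b; have -> : sigma (x b) = 1%g.
    by apply: (aut_free covF connC (x := x b)); rewrite -{2}(xK b) sigmaP.
  by apply: (addIr (chi 1%g)); rewrite add0r -addcharM mulg1.
Qed.

Lemma mor_cast (y y' z z' : B) (ey : y = y') (ez : z = z') (f : hom y z) :
  mor (p := (y', z')) (hom_cast ey ez f) = mor (p := (y, z)) f.
Proof. by case: y' / ey; case: z' / ez. Qed.

(** Stating membership in [total] removes the casts. *)
Lemma ZsetP (s : Aut1 F) c b (f : hom c b) : Zset xK s f <->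
  exists g : hom (s (x c)) (x b),
    tmap F (mor (p := (s (x c), x b)) g) = mor (p := (c, b)) f.
Proof.
split=> [[g _ <-]|[g gf]]; exists g => //.
- by rewrite mor_cast tmap_mor.
- move: gf; rewrite tmap_mor => gf.
  apply: (@dsum_in_inj k _ (@arrow k B) (c, b)).
  exact: etrans (mor_cast _ _ _) gf.
Qed.

Lemma Zset_linear (s : Aut1 F) c b a (f g : hom c b) :
  Zset xK s f -> Zset xK s g -> Zset xK s (a *: f + g).
Proof.
move=> /ZsetP[f' ff] /ZsetP[g' gg]; apply/ZsetP; exists (a *: f' + g').
by rewrite !linearP /= ff gg.
Qed.

Lemma Zset0 (s : Aut1 F) c b : Zset xK s (0 : hom c b).
Proof. by apply/ZsetP; exists 0; rewrite !linear0. Qed.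

(** The pieces span, every point of the fibre of [c] being of the form
    [s (x c)]. *)
Lemma Zset_ind c b (P : hom c b -> Prop) : P 0 ->
  (forall f g, P f -> P g -> P (f + g)) ->
  (forall s f, Zset xK s f -> P f) -> forall f, P f.
Proof.
move=> P0 PD PZ.
apply: (@lift_ind _ _ _ _ covF true (x b) (c, b)) => //=.
move=> -[y z] g f /= zb [yc _] gf.
subst z; have [s sy] : exists s : Aut1 F, s (x c) = y.
  by apply: aut_trans; rewrite xK yc.
by subst y; apply: (PZ s); apply/ZsetP; exists g.
Qed.

(** The pieces are independent: lift each component at [x b].  By freeness the
    lifts have pairwise distinct targets [s (x c)], so they do not interfere;
    their sum, being a lift of zero, vanishes. *)
Lemma Zset_indep c b (d : dsum (fun _ : Aut1 F => hom c b)) :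
  (forall s, Zset xK s (d s)) -> dsum_total d = 0 -> d = 0.
Proof.
move=> dZ d0; have [r [r_uniq dr dE]] := dsum_total_seq d.
pose idx (s : Aut1 F) := (s (x c), x b).
pose g s := projT1 (cid ((ZsetP s (d s)).1 (dZ s))).
have gd s : tmap F (mor (p := idx s) (g s)) = mor (p := (c, b)) (d s).
  by rewrite /g; case: cid.
have w0 : \sum_(s <- r) mor (p := idx s) (g s) = 0.
  apply: (side_inj covF (e := true) (x := x b)).
    elim/big_ind: _ => [| |s _]; [exact: on_side0|exact: on_sideD|].
    exact: (@on_side_mor _ _ true (idx s)).
  rewrite linear_sum; under eq_bigr do rewrite /= gd.
  by rewrite -linear_sum -dE d0 linear0.
apply: dsumP => s /=; apply/eqP; apply: contraT => ds0.
have gs0 : g s = 0.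
  have := congr1 (fun u : total C => u (idx s)) w0.
  rewrite dsum_sumE (bigD1_seq s) ?dr// big1 => [|t ts].
    by rewrite [LHS]addr0 /mor dsum_in_eq.
  rewrite /mor dsum_in_neq//; apply: contra_neqN ts => /eqP[].
  exact: (aut_inj covF connC).
move: (gd s) ds0; rewrite gs0 !linear0 => /esym/eqP.
rewrite -[0](linear0 (@mor k B (c, b))) => /eqP/dsum_in_inj ->.
by rewrite eqxx.
Qed.

Lemma Zdecomposition_holds : Zdecomposition xK.
Proof.
move=> c b f.
have [u [uZ uf]] : exists u : dsum (fun _ : Aut1 F => hom c b),
    (forall s, Zset xK s (u s)) /\ f = dsum_total u.
  move: f; apply: Zset_ind => [|f g [u [uZ ->]] [v [vZ ->]]|s f fZ].
  - by exists 0; rewrite linear0; split=> // s; exact: Zset0.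
  - exists (u + v); rewrite linearD; split=> // s.
    by rewrite /= -[u s]scale1r; exact: Zset_linear.
  - exists (dsum_in (M := fun=> hom c b) (i := s) f).
    rewrite dsum_total_in; split=> // t.
    have [<-|st] := eqVneq s t; first by rewrite dsum_in_eq.
    by rewrite dsum_in_neq//; exact: Zset0.
exists u; split=> // v [vZ vf].
apply/eqP; rewrite -subr_eq0; apply/eqP/Zset_indep => [s|].
  by rewrite /= -scaleN1r addrC; exact: Zset_linear.
by rewrite linearB /= -uf; apply/eqP; rewrite subr_eq0; apply/eqP.
Qed.

Lemma char_derivation_uniq chi D E :
  char_derivation xK chi D -> char_derivation xK chi E -> D = E.
Proof.
move=> Dchi Echi; apply: derivationP => c b; apply: Zset_ind.
- by rewrite !linear0.
- by move=> f g; rewrite !linearD /= => -> ->.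
- by move=> s f fZ; rewrite (Dchi s) ?(Echi s).
Qed.

(** A morphism in [Zset s] lifts to one from [x b] to [s (x c)], and the weights
    at the two ends differ by [chi s + phi (x c) - phi (x b) = chi s]. *)
Lemma graded_char_derivation (chi : addchar k (Aut1 F)) (phi : C -> k) D :
  equivariant chi phi ->
  (forall b, phi (x b) = 0) -> graded_der phi D -> char_derivation xK chi D.
Proof.
move=> phi_equiv phix Dphi s c b f /ZsetP[g gf].
rewrite (graded_der_mor Dphi _ gf)/= ?phi_equiv ?phix ?subr0 ?addr0//.
by rewrite /pmap /= aut1_fibre !xK.
Qed.

End Fibres.

(** The difference of the weights is invariant under [Aut1 F], so it comes from
    a function [al] on the objects of [B], and the difference of the derivations
    is inner, defined by the multiples [al b *: kid b] of the identities. *)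
Lemma graded_der_cohomologous (chi : addchar k (Aut1 F)) (phi psi : C -> k)
    (D E : derivation B) :
  equivariant chi phi -> equivariant chi psi ->
  graded_der phi D -> graded_der psi E -> der_class D = der_class E.
Proof.
move=> phi_equiv psi_equiv Dphi Epsi; apply/der_class_eq.
have [x xK] := choice covF.1.
pose al b := phi (x b) - psi (x b).
have alF y : al (F y) = phi y - psi y.
  have [s <-] : exists s : Aut1 F, s (x (F y)) = y.
    by apply: aut_trans; rewrite xK.
  by rewrite aut1_fibre xK phi_equiv psi_equiv opprD addrACA subrr add0r.
exists (fun b => al b *: kid b) => c b f; have [z zb] := covF.1 b; subst b.
rewrite kcompZl kcompZr kcomp1l kcomp1r -scalerBl.
move: c f; apply: hom_ind => [c|c f g Df Dg|y g].
- by rewrite !linear0.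
- by rewrite [LHS]linearD [X in X + _]Df [X in _ + X]Dg -scalerDr.
- rewrite /= Dphi Epsi !alF -scalerBl; congr (_ *: _).
  by rewrite opprD addrACA -opprD.
Qed.

End Galois.

Theorem theorem5p10 (k : fieldType) (C B : kcategory k) (F : kfunctor C B)
    (endoB : forall b : B, reduced_endo b) (galF : galois_covering F) :
  exists Delta : {linear addchar k (Aut1 F) -> HH1 B},
    injective Delta /\ canonical_map Delta.
Proof.
have [covF connC _] := galF.
have [x xK] := choice covF.1.
have [phi [phi_equiv _ phiL]] := weight_exists galF xK.
have /choice[D Dphi] chi := graded_der_exists galF (phi_equiv chi).
have DL : linear D.
  move=> a chi psi; apply: (graded_der_uniq galF (Dphi _)) => y z g /=.
  rewrite Dphi Dphi scalerA -scalerDl !phiL; congr (_ *: _).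
  by rewrite opprD addrACA mulrBr.
have DeltaL : linear (fun chi => der_class (D chi)).
  by move=> a chi psi; rewrite DL linearP.
pose Delta : {linear addchar k (Aut1 F) -> HH1 B} :=
  HB.pack (fun chi => der_class (D chi))
    (GRing.isLinear.Build k _ _ *:%R _ DeltaL).
exists Delta; split.
  suff Delta0 chi : Delta chi = 0 -> chi = 0.
    move=> chi psi /eqP; rewrite -subr_eq0 -linearB => /eqP /Delta0 /eqP.
    by rewrite subr_eq0 => /eqP.
  have -> : 0 = der_class (0 : derivation B) by rewrite linear0.
  move=> /der_class_eq[al]; rewrite subr0 => Dal.
  have /choice[a alE] b : exists a, al b = a *: kid b.
    by have [g _ gK] := endoB b; exists (g (al b)); rewrite gK.
  (* [D chi] multiplies [F g] both by the difference of [phi chi] and by the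
     difference of [a] at the ends of [g]; these agree when [g] is nonzero. *)
  have const y z : phi chi y - a (F y) = phi chi z - a (F z).
    pose Q w := phi chi y - a (F y) = phi chi w - a (F w).
    apply: (connected_ind connC (Q := Q) _ z (erefl : Q y)) => e p f f0 Qp.
    have Ff0 : fmap F f != 0 by apply: contra_neq f0; exact: (fmap_eq0 galF).
    have := Dal _ _ (fmap F f).
    rewrite Dphi !alE kcompZl kcompZr kcomp1l kcomp1r.
    move/eqP; rewrite -scalerBl -subr_eq0 -scalerBl scaler_eq0 (negPf Ff0) orbF.
    rewrite subr_eq0 => /eqP pE; rewrite /Q Qp.
    have pp : phi chi p.1 - a (F p.1) = phi chi p.2 - a (F p.2).
      rewrite -[phi chi p.1](subrK (phi chi p.2)) pE.
      by rewrite [LHS]addrC !addrA addNr add0r addrC.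
    by case: (e).
  have [b _] := (let: And3 _ _ e := galF in e); apply: addcharP => s /=.
  have := const (s (x b)) (x b).
  by rewrite phi_equiv aut1_fibre -addrA => /(canRL (addrK _)); rewrite subrr.
move=> x' xK'; split; first exact: Zdecomposition_holds.
move=> chi; have [psi [psi_equiv psi_x _]] := weight_exists galF xK'.
have [E Epsi] := graded_der_exists galF (psi_equiv chi).
have Echi : char_derivation xK' chi E.
  exact: graded_char_derivation (psi_equiv chi) (psi_x chi) Epsi.
exists E; split; last first.
  exact: (graded_der_cohomologous galF (phi_equiv chi) (psi_equiv chi)).
by split=> // E' E'chi; exact: (char_derivation_uniq galF Echi E'chi).
Qed.
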